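(* Let $d=(d_1,\ldots,d_n)$ be a degree sequence with $d_4\ge 2$, $\sum_i d_i>2n$ and $\mu_1>0$, and let $m=\frac12\sum_i d_i$. Then $d$ has a core bipartite cactus realization if and only if $\mu_1\ge\mu_{odd}$ and $m\le\left\lfloor\frac{4(n-1)-\mu_1}{3}\right\rfloor$.
   Context: A degree sequence is a sequence of integers $d_i\in\{1,\ldots,n-1\}$ with even sum and $d_1\ge\cdots\ge d_n$; a realization is a simple graph on $\{1,\ldots,n\}$ with $\deg(i)=d_i$. A cactus is a connected simple graph in which every edge lies on at most one cycle; a bridge is an edge whose removal disconnects the graph; a core cactus is a cactus with no bridge whose removal splits the graph into two components each containing a cycle; a core bi-cactus is a core cactus that is bipartite. $\mu_1$ is the number of entries of $d$ equal to $1$, and $\mu_{odd}$ is the number of entries that are odd integers greater than $1$. *)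

(* Defs.v *)
From mathcomp Require Import all_boot.
Set Implicit Arguments. Unset Strict Implicit. Unset Printing Implicit Defensive.

(* Degree sequences are seq nat, 0-based: d_i (paper, 1-based) is nth 0 d (i-1). *)
Definition degree_sequence (n : nat) (d : seq nat) : Prop :=
  [/\ size d = n,
      all (fun x => (1 <= x) && (x <= n - 1)) d,
      ~~ odd (sumn d) &
      sorted geq d].

Definition mu1 (d : seq nat) : nat := count (fun x => x == 1) d.
Definition mu_odd (d : seq nat) : nat := count (fun x => odd x && (1 < x)) d.

Section Graphs.
Variable T : finType.

Definition simple_graph (e : rel T) : Prop :=
  symmetric e /\ irreflexive e.

Definition graph_cycle (e : rel T) (c : seq T) : bool :=
  [&& uniq c, 3 <= size c & cycle e c].

Definition cycle_edges (c : seq T) : {set T * T} :=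
  [set p | (p.1 \in c) && ((next c p.1 == p.2) || (prev c p.1 == p.2))].

Definition edge_on_cycle (c : seq T) (u v : T) : bool :=
  (u, v) \in cycle_edges c.

Definition connected (e : rel T) : Prop := forall x y : T, connect e x y.

Definition cactus (e : rel T) : Prop :=
  connected e /\
  forall (u v : T) (c1 c2 : seq T), e u v ->
    graph_cycle e c1 -> graph_cycle e c2 ->
    edge_on_cycle c1 u v -> edge_on_cycle c2 u v ->
    cycle_edges c1 = cycle_edges c2.

Definition remove_edge (e : rel T) (u v : T) : rel T :=
  fun x y => e x y && ~~ (((x == u) && (y == v)) || ((x == v) && (y == u))).

Definition is_bridge (e : rel T) (u v : T) : Prop :=
  e u v /\ ~~ connect (remove_edge e u v) u v.

Definition comp_has_cycle (e : rel T) (x : T) : Prop :=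
  exists c : seq T, graph_cycle e c /\ all (connect e x) c.

Definition core_cactus (e : rel T) : Prop :=
  cactus e /\
  forall u v : T, is_bridge e u v ->
    ~ (comp_has_cycle (remove_edge e u v) u /\ comp_has_cycle (remove_edge e u v) v).

Definition bipartite (e : rel T) : Prop :=
  exists f : T -> bool, forall x y, e x y -> f x != f y.

Definition core_bicactus (e : rel T) : Prop := core_cactus e /\ bipartite e.

End Graphs.

(* e is a realization of d on vertex set {0,..,n-1} (vertex i has degree d_(i+1)) *)
Definition realizes (n : nat) (d : seq nat) (e : rel 'I_n) : Prop :=
  simple_graph e /\ forall i : 'I_n, #|[set j | e i j]| = nth 0 d i.

(* Main.v *)
Require Import Defs.
From mathcomp Require Import all_boot.
From mathcomp Require Import zify.
Set Implicit Arguments. Unset Strict Implicit. Unset Printing Implicit Defensive.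

(** Let R be the set of vertices lying on cycles, r its size, and k = m - n + 1.

    Necessity. Removing one edge from every cycle leaves a forest, so there are
    at least k cycles; they are edge-disjoint and of length at least 4, so at
    least 4k edges lie on cycles. All other edges are bridges, and since exactly
    one side of a bridge meets R, they are in bijection with the n - r vertices
    outside R. Hence m >= 4k + n - r, while r <= n - mu_1. For the parity
    condition, every vertex lies on an even number of cycle edges, so an odd
    vertex of R is incident to a bridge; comparing with the total bridge degree
    2(n - r) gives mu_odd <= mu_1.

    Sufficiency. Choose 3k + 1 vertices of degree at least 2 and multiplicities
    c_v >= 1 with 2 c_v <= d_v and total 4k, not all of these inequalities
    being equalities. The chosen vertices carry a tree of k four-cycles with c_v
    of them through v, and all remaining vertices, those of degree at least 2
    first, can be attached one by one as leaves. Using only four-cycles makes the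
    graph bipartite without any parity condition on the number of vertices. *)

(** * Cardinals as sums of indicators *)

Lemma card_set_sum (T : finType) (P : pred T) : #|[set x | P x]| = \sum_x P x.
Proof.
by rewrite -sum1_card big_mkcond; apply: eq_bigr => x _; rewrite inE; case: ifP.
Qed.

Lemma sum_eq1 (T : finType) (z : T) : \sum_x (x == z : nat) = 1.
Proof.
rewrite -card_set_sum (_ : [set x | _] = [set z]) ?cards1 //.
by apply/setP => x; rewrite !inE.
Qed.

(** * Edges of a cycle, and non-bridges as the edges lying on cycles *)

Section Cycles.
Variable T : finType.
Implicit Types (e f : rel T) (c : seq T) (x y u v : T).

Lemma remove_edgeC e u v : remove_edge e u v =2 remove_edge e v u.
Proof. by move=> x y; rewrite /remove_edge orbC. Qed.

Lemma remove_edge_sub e u v : subrel (remove_edge e u v) e.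
Proof. by move=> x y /andP[]. Qed.

Lemma remove_edge_mono e f u v :
  subrel e f -> subrel (remove_edge e u v) (remove_edge f u v).
Proof. by move=> ef x y /andP[/ef fxy nxy]; rewrite /remove_edge fxy. Qed.

Lemma remove_edge_sym e u v : symmetric e -> symmetric (remove_edge e u v).
Proof.
move=> es x y; rewrite /remove_edge es orbC.
by rewrite [(y == u) && _]andbC [(y == v) && _]andbC.
Qed.

Lemma connect_mono e f : subrel e f -> subrel (connect e) (connect f).
Proof. by move=> ef; apply: connect_sub => x y /ef /connect1. Qed.

Lemma cycle_edges_rel e c u v :
  symmetric e -> graph_cycle e c -> (u, v) \in cycle_edges c -> e u v.
Proof.
move=> es /and3P[_ _ cc]; rewrite inE /= => /andP[uc /orP[] /eqP <-].
  exact: next_cycle cc uc.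
by rewrite es; apply: prev_cycle cc uc.
Qed.

Lemma next_cycle_edges c x : x \in c -> (x, next c x) \in cycle_edges c.
Proof. by move=> xc; rewrite inE /= xc eqxx. Qed.

Lemma cycle_edges_sym c u v :
  uniq c -> ((u, v) \in cycle_edges c) = ((v, u) \in cycle_edges c).
Proof.
move=> uc; wlog suff: u v / (u, v) \in cycle_edges c -> (v, u) \in cycle_edges c.
  by move=> H; apply/idP/idP; apply: H.
rewrite !inE /= => /andP[uC /orP[] /eqP <-].
  by rewrite mem_next uC prev_next // eqxx orbT.
by rewrite mem_prev uC next_prev // eqxx.
Qed.

Lemma mem_cycle_edges c u v : (u, v) \in cycle_edges c -> (u \in c) && (v \in c).
Proof.
by rewrite inE /= => /andP[uc /orP[] /eqP <-]; rewrite ?mem_next ?mem_prev uc.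
Qed.

(** If both neighbours coincided, two steps along [c] from [x] would lead back to [x]; after
    rotating [x] to the front, this contradicts the length being at least 3. *)
Lemma next_neq_prev c x : uniq c -> 2 < size c -> x \in c -> next c x != prev c x.
Proof.
move=> uc sc xc; apply/eqP => nP.
have: next c (next c x) = x by rewrite nP next_prev.
have [i p rc] := rot_to xc.
have sp : size (x :: p) = size c by rewrite -rc size_rot.
have up : uniq (x :: p) by rewrite -rc rot_uniq.
have nr y : next c y = next (x :: p) y by rewrite -rc next_rot.
rewrite !{}nr; case: p sp up {rc} => [|y [|z p]] sp; try by move: sp sc => /= <-.
rewrite /= eqxx !inE !negb_or => /andP[/and3P[nxy nxz _] _].
by rewrite eq_sym (negPf nxy) eqxx => zx; rewrite zx eqxx in nxz.
Qed.

Definition arcs_from (A : {set T * T}) x := [set y | (x, y) \in A].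

Lemma in_arcs_from A x y : (y \in arcs_from A x) = ((x, y) \in A).
Proof. by rewrite inE. Qed.

Lemma card_cycle_row c x : uniq c -> 2 < size c ->
  #|arcs_from (cycle_edges c) x| = if x \in c then 2 else 0.
Proof.
move=> uc sc; case: ifP => xc; last first.
  by apply: eq_card0 => y; rewrite in_arcs_from inE /= xc.
rewrite (_ : arcs_from _ _ = [set next c x; prev c x]).
  by rewrite cards2 next_neq_prev.
by apply/setP => y; rewrite in_arcs_from !inE /= xc /= ![_ == y]eq_sym.
Qed.

(* Every vertex has exactly two neighbours on either cycle, so the vertex set
   of the smaller cycle is closed under moving along the larger one. *)
Lemma cycle_edges_subset_eq e f c1 c2 :
  graph_cycle e c1 -> graph_cycle f c2 ->
  cycle_edges c1 \subset cycle_edges c2 -> cycle_edges c1 = cycle_edges c2.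
Proof.
move=> /and3P[u1 s1 _] /and3P[u2 s2 _] sub.
have row x : x \in c1 ->
    arcs_from (cycle_edges c1) x = arcs_from (cycle_edges c2) x.
  move=> xc; apply/eqP; rewrite eqEcard; apply/andP; split.
    by apply/subsetP => y; rewrite !in_arcs_from; apply: (subsetP sub).
  by rewrite !card_cycle_row // xc; case: ifP.
have [x xc1] : exists x, x \in c1.
  by case: (c1) s1 => // x s _; exists x; rewrite inE eqxx.
have xc2 : x \in c2.
  have: (x, next c1 x) \in cycle_edges c2.
    by apply: (subsetP sub); rewrite inE /= xc1 eqxx.
  by case/mem_cycle_edges/andP.
have c21 y : y \in c2 -> y \in c1.
  rewrite -(fconnect_cycle (cycle_next u2) xc2) => /iter_findex <-.
  elim: (findex _ _ _) => //= i; set z := iter _ _ _ => zc.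
  have: next c2 z \in arcs_from (cycle_edges c2) z.
    rewrite in_arcs_from inE /= eqxx andbT /z; elim: (i) => //= j.
    by rewrite mem_next.
  by rewrite -row // in_arcs_from => /mem_cycle_edges/andP[].
apply/eqP; rewrite eqEsubset sub; apply/subsetP => -[y z] yz.
have yc : y \in c1 by case/mem_cycle_edges/andP: yz => /c21.
by move/setP: (row _ yc) => /(_ z); rewrite !in_arcs_from yz => ->.
Qed.

(** The rest of the cycle is a detour. With [v] next after [u], the part from [v] up to the
    predecessor of [u] avoids [u], hence the removed edge, and one more edge returns to [u]. *)
Lemma cycle_edge_nonbridge e c u v :
  symmetric e -> graph_cycle e c -> (u, v) \in cycle_edges c ->
  connect (remove_edge e u v) u v.
Proof.
move=> es gc; wlog nx : u v / next c u = v => [H|].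
  move=> uv; case/and3P: (gc) => uc _ _.
  move: (uv); rewrite inE /= => /andP[uC /orP[] /eqP E]; first exact: H.
  have nv : next c v = u by rewrite -E next_prev.
  rewrite sym_connect_sym; last exact: remove_edge_sym.
  rewrite (eq_connect (remove_edgeC _ _ _)); apply: H => //.
  by rewrite cycle_edges_sym.
case/and3P: gc => uc sc cc; case/mem_cycle_edges/andP=> uC _.
have [i p rc] := rot_to uC.
have sp : size (u :: p) = size c by rewrite -rc size_rot.
have up : uniq (u :: p) by rewrite -rc rot_uniq.
have cp : cycle e (u :: p) by rewrite -rc rot_cycle.
move: nx; rewrite -(next_rot i) // rc.
case: p sp up cp {rc} => [|y [|z p]] sp; try by move: sp sc => /= <-.
rewrite /= eqxx => /and4P[nu ny nz up] /and3P[uy yz zp] yv.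
move: uy yz nu ny; rewrite {}yv {sp y} => uy yz nu ny.
rewrite sym_connect_sym; last exact: remove_edge_sym.
have vu : v != u by move: nu; rewrite inE negb_or eq_sym; case/andP.
move: zp; rewrite rcons_path => /andP[zp lu].
have lst : last z p \in z :: p by exact: mem_last.
apply: (@connect_trans _ _ (last z p)).
  apply/connectP; exists (z :: p) => //.
  apply: (@sub_in_path _ (predC1 u) e) => [x y /= xu yu exy||].
  - by rewrite /remove_edge exy (negPf xu) (negPf yu) andbF.
  - by apply/allP => x xin /=; apply: contraNneq nu => <-.
  - by rewrite /= yz.
apply: connect1; rewrite /remove_edge lu /= eqxx andbT negb_or.
have [E|_] := eqVneq (last z p) u.
  by move: nu; rewrite inE -E lst orbT.
by have [E|_] := eqVneq (last z p) v; first by rewrite -E lst in ny.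
Qed.

(** A simple detour from [u] to [v] closes up with the edge. It has at least two edges: an empty one
    would make [u v] a loop, and a single edge would be the removed one. *)
Lemma nonbridge_cycle e u v : symmetric e -> irreflexive e -> e u v ->
  connect (remove_edge e u v) u v ->
  exists2 c, graph_cycle e c & (u, v) \in cycle_edges c.
Proof.
move=> es ei euv /connectP[p0 /shortenP[p pp up _] vl].
have epp : path e u p by apply: sub_path pp; apply: remove_edge_sub.
exists (u :: p).
  apply/and3P; split => //=; last by rewrite rcons_path epp -vl es.
  case: p pp vl {up epp} => [|y [|z p]] //=.
    by move=> _ E; rewrite E ei in euv.
  by rewrite andbT /remove_edge => /andP[_] /[swap] ->; rewrite !eqxx.
have up' : u \notin p by case/andP: up.
have P : prev (u :: p) (u, v).1 = v.
  by rewrite prev_nth mem_head memNindex // -[size p]/((size (u :: p)).-1) nth_last.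
by rewrite inE P eqxx orbT andbT mem_head.
Qed.

End Cycles.

(** * Counting bridges *)

Section Bridges.
Variable T : finType.
Implicit Types (e f : rel T) (c : seq T) (x y u v : T) (R : {set T}).

(** Edges are counted as ordered pairs, so for a symmetric loopless relation this set has size 2m,
    the degree sum; hence the doubled constants in the counts below. *)
Definition arcs e : {set T * T} := [set a | e a.1 a.2].

Definition bridge_arcs e : {set T * T} :=
  [set a in arcs e | ~~ connect (remove_edge e a.1 a.2) a.1 a.2].

Lemma in_bridge_arcs e x y :
  ((x, y) \in bridge_arcs e) = e x y && ~~ connect (remove_edge e x y) x y.
Proof. by rewrite !inE. Qed.

(** After its last visit to [x] or [y], a walk from [x] to [z] no longer uses the removed edge. The
    induction runs along the reversed walk. *)
Lemma connect_remove_edge e x y z : symmetric e -> connect e x z ->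
  connect (remove_edge e x y) x z || connect (remove_edge e x y) y z.
Proof.
move=> es; rewrite sym_connect_sym // => /connectP[p pp xl].
elim: p z pp xl => [|w p IHp] z /=; first by move=> _ <-; rewrite connect0.
case/andP=> zw /IHp{}IHp /IHp; set r := remove_edge e x y.
have [->|nzx] := eqVneq z x; first by rewrite connect0.
have [->|nzy] := eqVneq z y; first by rewrite connect0 orbT.
have wz : r w z.
  by rewrite /r /remove_edge es zw /= negb_or (negPf nzx) (negPf nzy) !andbF.
by case/orP=> H; rewrite (connect_trans H (connect1 wz)) ?orbT.
Qed.

(* A bridge has exactly one side that meets R; sending it to its endpoint on the
   other side is a bijection onto the complement of R. *)
Lemma card_bridge_arcs e R : symmetric e ->
  (forall x, exists2 r, r \in R & connect e x r) ->
  (forall x y, (x, y) \in bridge_arcs e -> forall r s, r \in R -> s \in R ->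
     connect (remove_edge e x y) x r -> ~~ connect (remove_edge e x y) y s) ->
  (forall x y, e x y -> x \notin R -> (x, y) \in bridge_arcs e) ->
  #|bridge_arcs e| = 2 * #|~: R|.
Proof.
move=> es HR Hone Hout.
(* [B] holds the bridges oriented towards their side meeting [R]. It and its reversal partition all
   bridge arcs, and taking tails maps [B] bijectively onto the complement of [R]. *)
pose B := [set a in bridge_arcs e |
            [exists r in R, connect (remove_edge e a.1 a.2) a.2 r]].
have inB x y : ((x, y) \in B) = ((x, y) \in bridge_arcs e) &&
    [exists r in R, connect (remove_edge e x y) y r] by rewrite inE.
pose sw (a : T * T) := (a.2, a.1).
have swK : involutive sw by case.
have brC x y : ((x, y) \in bridge_arcs e) = ((y, x) \in bridge_arcs e).
  rewrite !in_bridge_arcs es (eq_connect (remove_edgeC _ _ _)).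
  by rewrite sym_connect_sym //; apply: remove_edge_sym.
have -> : bridge_arcs e = B :|: sw @: B.
  apply/setP => -[x y]; rewrite in_setU -[X in _ \in imset X _]/sw.
  rewrite -[(x, y) in X in _ = _ || X](swK (x, y)) mem_imset; last exact: inv_inj.
  rewrite !inB [in RHS]brC -brC -andb_orr.
  case br: ((x, y) \in _) => //=; symmetry.
  have [r rR /(connect_remove_edge y es)] := HR x.
  case/orP => [cx|cy]; apply/orP; [right|left]; apply/existsP; exists r; rewrite rR //=.
  by rewrite (eq_connect (remove_edgeC _ _ _)).
have dis : [disjoint B & sw @: B].
  apply/pred0P => -[x y] /=.
  rewrite -[(x, y) in X in _ && X](swK (x, y)) mem_imset; last exact: inv_inj.
  rewrite !inB; apply/negP => /and3P[/andP[br /existsP[r /andP[rR yr]]] _].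
  case/existsP=> s /andP[sR]; rewrite (eq_connect (remove_edgeC _ _ _)) => xs.
  by move: (Hone _ _ br _ _ sR rR xs); rewrite yr.
rewrite cardsU (disjoint_setI0 dis) cards0 subn0 card_imset; last exact: inv_inj.
rewrite addnn -mul2n; congr (2 * _).
suff <- : [set a.1 | a in B] = ~: R.
  rewrite card_in_imset // => -[x y] [x' y'] /= + + E.
  rewrite -{}E !inB => /andP[br /existsP[r /andP[rR yr]]].
  case/andP=> br' /existsP[s /andP[sR ys]].
  (* With two such arcs out of [x], the walk to [R] through [y] avoids the bridge to [y'], so both
     sides of that bridge would meet [R]. *)
  have [-> //|nyy] := eqVneq y y'; exfalso.
  have xr : connect (remove_edge e x y') x r.
    apply: (@connect_trans _ _ y).
      apply: connect1; rewrite /remove_edge; move: br; rewrite in_bridge_arcs => /andP[-> _].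
      rewrite eqxx (negPf nyy) /=; apply/andP => -[/eqP E /eqP E2].
      by rewrite E2 E eqxx in nyy.
    case/connectP: yr => p pp ->; apply/connectP; exists p => //.
    apply: (@sub_in_path _ (connect (remove_edge e x y) y) (remove_edge e x y)) (pp).
      move=> a b /= ya yb /andP[eab _]; rewrite /remove_edge eab negb_or.
      move: br; rewrite in_bridge_arcs => /andP[_ nc'].
      rewrite sym_connect_sym in nc'; last exact: remove_edge_sym.
      have [E|_] := eqVneq a x; first by case/negP: nc'; move: ya; rewrite E.
      have [E|_] := eqVneq b x; first by case/negP: nc'; move: yb; rewrite E.
      by rewrite andbF.
    exact/allP/path_connect.
  by move: (Hone _ _ br' _ _ rR sR xr); rewrite ys.
apply/setP => x; rewrite inE; apply/imsetP/idP.
  case=> -[x' y]; rewrite inB => /andP[br /existsP[r /andP[rR yr]]] /= ->.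
  apply/negP => xR; move: (Hone _ _ br _ _ xR rR (connect0 _ _)).
  by rewrite yr.
(* The arc of [B] starting at [x] is the first edge of a simple path from [x] to [R]; the rest of
   that path never returns to [x]. *)
move=> xR; have [r rR /connectP[p0 /shortenP[p pp up _] rl]] := HR x.
case: p pp up rl => [|y p] /=; first by move=> _ _ E; rewrite -E rR in xR.
case/andP=> exy pp /andP[nx _] rl; exists (x, y) => //.
rewrite inB Hout //=; apply/existsP; exists r; rewrite rR /=.
apply/connectP; exists p => //.
apply: (@sub_in_path _ (predC1 x) e) pp => [a b /= ax bx eab|].
  by rewrite /remove_edge eab (negPf ax) (negPf bx) andbF.
by apply/allP => z zin /=; apply: contraNneq nx => <-.
Qed.

(** Apply the bridge count with [R] consisting of one root per component. Two roots on opposite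
    sides of a bridge would be equal and reconnect its ends. As [R] is nonempty, at most |T| - 1
    edges remain. *)
Lemma card_acyclic e (r : T) : symmetric e ->
  bridge_arcs e = arcs e -> #|arcs e| + 2 <= 2 * #|T|.
Proof.
move=> es ac; have cs := sym_connect_sym es.
pose R := [set x | root e x == x].
have rR x : root e x \in R by rewrite inE root_root.
rewrite -ac (card_bridge_arcs (R := R)) //.
- have := cardsC R; have : 0 < #|R| by apply/card_gt0P; exists (root e r).
  by lia.
- by move=> x; exists (root e x); rewrite // connect_root.
- move=> x y br a b; rewrite !inE => /eqP aR /eqP bR xa; apply/negP => yb.
  have sub := connect_mono (@remove_edge_sub _ e x y).
  move: (br); rewrite in_bridge_arcs => /andP[exy /negP]; apply.
  have ab : a = b.
    rewrite -aR -bR; apply/eqP; rewrite root_connect //.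
    apply: (@connect_trans _ _ x); first by rewrite cs; apply: sub.
    by apply: (@connect_trans _ _ y); [apply: connect1 | apply: sub].
  apply: (connect_trans xa); rewrite ab sym_connect_sym //.
  exact: remove_edge_sym.
- by move=> x y exy _; rewrite ac inE.
Qed.

Lemma card_arcs (A : {set T * T}) : #|A| = \sum_x #|arcs_from A x|.
Proof.
rewrite -sum1_card (eq_bigr (fun x => \sum_(y in arcs_from A x) 1)).
  rewrite pair_big_dep /=; apply: eq_bigl => -[x y] /=.
  by rewrite in_arcs_from.
by move=> x _; rewrite sum1_card.
Qed.

End Bridges.

(** * The set of all cycles of a graph *)

Section CycleSets.
Variable T : finType.
Implicit Types (e f : rel T) (c : seq T) (x y u v : T) (X : {set T * T}).

(** A cycle is identified with its edge set, so that rotations and reversals count once. Bounding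
    the length by |T| makes the existential range over a finite type. *)
Definition cycle_sets e : {set {set T * T}} :=
  [set X | [exists k : 'I_#|T|.+1, exists t : k.-tuple T,
     graph_cycle e t && (cycle_edges t == X)]].

Lemma cycle_setsP e X :
  reflect (exists2 c, graph_cycle e c & X = cycle_edges c) (X \in cycle_sets e).
Proof.
rewrite inE; apply: (iffP existsP) => [[k /existsP[t /andP[gc /eqP <-]]]|].
  by exists t.
case=> c gc ->; have sc : size c < #|T|.+1.
  by case/and3P: gc => /card_uniqP <- _ _; rewrite ltnS max_card.
exists (Ordinal sc); apply/existsP; exists (in_tuple c).
by rewrite gc eqxx.
Qed.

Definition cycle_vertices e := [set x | 0 < #|arcs_from (cover (cycle_sets e)) x|].

Lemma mem_cycle_verticesP e x :
  reflect (exists2 c, graph_cycle e c & x \in c) (x \in cycle_vertices e).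
Proof.
rewrite inE; apply: (iffP card_gt0P) => [[y]|[c gc xc]].
  rewrite in_arcs_from => /bigcupP[X /cycle_setsP[c gc ->] /mem_cycle_edges].
  by case/andP=> xc _; exists c.
exists (next c x); rewrite in_arcs_from; apply/bigcupP; exists (cycle_edges c).
  by apply/cycle_setsP; exists c.
by rewrite inE /= xc eqxx.
Qed.

Lemma mem_cover_sum (K : {set {set T * T}}) a :
  trivIset K -> (a \in cover K : nat) = \sum_(X in K) (a \in X).
Proof.
move=> tK; have [/bigcupP[X XK aX]|aN] := boolP (a \in cover K).
  rewrite (bigD1 X) //= aX big1 // => Y /andP[YK YX].
  rewrite eq_sym in YX.
  by have /pred0P/(_ a) := trivIsetP tK _ _ XK YK YX; rewrite /= aX /= => ->.
rewrite big1 // => X XK; case aX: (a \in X) => //; case/negP: aN.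
by apply/bigcupP; exists X.
Qed.

Lemma card_arcs_from_cover (K : {set {set T * T}}) x : trivIset K ->
  #|arcs_from (cover K) x| = \sum_(X in K) #|arcs_from X x|.
Proof.
move=> tK; rewrite -sum1_card big_mkcond /=.
rewrite (eq_bigr (fun y => \sum_(X in K) ((x, y) \in X : nat))).
  rewrite exchange_big /=; apply: eq_bigr => X _.
  rewrite -[RHS]sum1_card [RHS]big_mkcond; apply: eq_bigr => y _.
  by rewrite in_arcs_from; case: ifP.
by move=> y _; rewrite in_arcs_from -mem_cover_sum //; case: ifP.
Qed.

Variable e : rel T.
Hypotheses (e_sym : symmetric e) (e_irr : irreflexive e).
Let K := cycle_sets e.

(** This makes cycle arcs and bridge arcs complementary, so that degrees and the total number of
    arcs split into the two kinds. *)
Lemma cover_cycle_setsE x y :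
  ((x, y) \in cover K) = e x y && connect (remove_edge e x y) x y.
Proof.
apply/bigcupP/andP => [[X /cycle_setsP[c gc ->] xy]|[exy cxy]].
  by split; [apply: cycle_edges_rel xy | apply: cycle_edge_nonbridge xy].
have [c gc xy] := nonbridge_cycle e_sym e_irr exy cxy.
by exists (cycle_edges c) => //; apply/cycle_setsP; exists c.
Qed.

Lemma card_arcs_from_split x : #|arcs_from (arcs e) x| =
  #|arcs_from (bridge_arcs e) x| + #|arcs_from (cover K) x|.
Proof.
rewrite -(cardsID (arcs_from (bridge_arcs e) x) (arcs_from _ x)).
congr (_ + _); apply: eq_card => y.
  by rewrite in_setI !in_arcs_from in_bridge_arcs inE /= andbA andbb.
rewrite in_setD !in_arcs_from in_bridge_arcs cover_cycle_setsE inE /=.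
by case: (e x y); rewrite //= negbK andbT.
Qed.

Lemma card_arcs_split :
  #|arcs e| = #|bridge_arcs e| + #|cover K|.
Proof.
by rewrite !card_arcs -big_split; apply: eq_bigr => x _; apply: card_arcs_from_split.
Qed.

Lemma even_cycle_degree x : trivIset K -> ~~ odd #|arcs_from (cover K) x|.
Proof.
move=> tK; rewrite card_arcs_from_cover //; elim/big_ind: _ => //.
  by move=> a b; rewrite oddD => /negPf-> /negPf->.
move=> X /cycle_setsP[c /and3P[uc sc _] ->].
by rewrite card_cycle_row //; case: ifP.
Qed.

(* Deleting one edge of every cycle leaves a forest. *)
Lemma card_cycle_sets (r : T) : #|arcs e| + 2 <= 2 * #|T| + 2 * #|K|.
Proof.
(* [a] picks the arc to delete from each cycle; the default is never reached, since cycles have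
   edges. *)
pose a X : T * T := odflt (r, r) [pick p in X].
have aP X : X \in K -> a X \in X.
  case/cycle_setsP=> c /and3P[_ sc _] ->; rewrite /a; case: pickP => //=.
  case: c sc => // x c _ /(_ (x, next (x :: c) x)).
  by rewrite inE /= inE !eqxx.
pose f x y := e x y && ~~ [exists X in K, (a X == (x, y)) || (a X == (y, x))].
have fe : subrel f e by move=> x y /andP[].
have fs : symmetric f.
  move=> x y; rewrite /f e_sym; congr (_ && ~~ _).
  by apply: eq_existsb => X; rewrite orbC.
have fac : bridge_arcs f = arcs f.
  apply/setP => -[x y]; rewrite in_bridge_arcs [in RHS]inE /=.
  case fxy: (f x y) => //=; apply/negP => cxy.
  have fi : irreflexive f by move=> z; rewrite /f e_irr.
  (* A cycle left in [f] is also a cycle of [e], so one of its own arcs has been deleted. *)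
  have [c gc _] := nonbridge_cycle fs fi fxy cxy.
  have XK : cycle_edges c \in K.
    apply/cycle_setsP; exists c => //; case/and3P: gc => uc sc cc.
    by apply/and3P; split=> //; apply: sub_cycle cc.
  have := aP _ XK; case E: (a (cycle_edges c)) => [u v].
  move/(cycle_edges_rel fs gc) => /andP[_ /existsP[]].
  by exists (cycle_edges c); rewrite XK E eqxx.
pose sw (p : T * T) := (p.2, p.1).
have sub : arcs e \subset arcs f :|: (a @: K :|: sw @: (a @: K)).
  apply/subsetP => -[x y]; rewrite inE /= => exy; rewrite in_setU.
  rewrite inE /= /f exy /=; case: existsP => //= -[X /andP[XK aX]].
  rewrite in_setU; apply/orP; case/orP: aX => /eqP E; [left|right].
    by rewrite -E; apply: imset_f.
  by rewrite -[(x, y)]/(sw (y, x)) -E; do 2!apply: imset_f.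
have le : #|arcs e| <= #|arcs f| + (#|K| + #|K|).
  apply: leq_trans (subset_leq_card sub) _.
  apply: leq_trans (leq_card_setU _ _) _; rewrite leq_add2l.
  apply: leq_trans (leq_card_setU _ _) _; apply: leq_add; first exact: leq_imset_card.
  exact: leq_trans (leq_imset_card _ _) (leq_imset_card _ _).
by have := card_acyclic r fs fac; lia.
Qed.

End CycleSets.

(** * Necessity: bounds satisfied by every core bi-cactus *)

Section Necessity.
Variables (T : finType) (e : rel T).
Hypotheses (e_sym : symmetric e) (e_irr : irreflexive e) (e_core : core_bicactus e).
Let K := cycle_sets e.
Let R := cycle_vertices e.

Lemma trivIset_cycle_sets : trivIset K.
Proof.
have [[[_ cact] _] _] := e_core.
apply/trivIsetP => X Y /cycle_setsP[c1 g1 ->] /cycle_setsP[c2 g2 ->] nXY.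
apply/pred0P => -[u v] /=; apply/negP => /andP[uv1 uv2]; case/eqP: nXY.
by apply: (cact u v) => //; apply: cycle_edges_rel uv1.
Qed.

(** The cycles are edge-disjoint, and bipartiteness excludes triangles, so each one contributes at
    least four edges, that is eight arcs. *)
Lemma card_cover_cycle_sets : 8 * #|K| <= #|cover K|.
Proof.
have [_ [f fP]] := e_core.
have/eqP := trivIset_cycle_sets; rewrite /trivIset => <-.
rewrite mulnC -sum_nat_const; apply: leq_sum => X /cycle_setsP[c /and3P[uc sc cc] ->].
rewrite card_arcs (eq_bigr (fun x => if x \in c then 2 else 0)); last first.
  by move=> x _; rewrite card_cycle_row.
rewrite -big_mkcond /= sum_nat_const (card_uniqP uc).
suff: size c != 3 by lia.
apply/eqP; case: c cc {uc sc} => [|x [|y [|z []]]] //=.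
rewrite andbT => /and3P[/fP + /fP + /fP + _].
by case: (f x); case: (f y); case: (f z).
Qed.

(** No cycle uses a bridge, so a side of a bridge that meets [R] contains a whole cycle; the core
    condition forbids this on both sides. A cycle is needed for [R] to be nonempty. *)
Lemma card_bridge_arcs_core : 0 < #|K| ->
  #|bridge_arcs e| = 2 * #|~: R|.
Proof.
have [[[conn cact] core] _] := e_core.
move=> /card_gt0P[X /cycle_setsP[c0 gc0 _]].
apply: card_bridge_arcs => //.
- move=> x; case: c0 gc0 => [/and3P[]//|r c] gc; exists r; last exact: conn.
  by apply/mem_cycle_verticesP; exists (r :: c); rewrite // mem_head.
- move=> x y; rewrite in_bridge_arcs => /andP[exy br] r s.
  have side z w : connect (remove_edge e x y) z w -> w \in R ->
      comp_has_cycle (remove_edge e x y) z.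
    move=> zw /mem_cycle_verticesP[c gc wc].
    have gc' : graph_cycle (remove_edge e x y) c.
      case/and3P: (gc) => uc sc cc; apply/and3P; split=> //.
      apply: (cycle_from_next uc) => u uC; rewrite /remove_edge (next_cycle cc uC) /=.
      have E : (u, next c u) \in cycle_edges c by rewrite inE /= uC eqxx.
      apply/norP; split; apply/andP => -[/eqP E1 /eqP E2]; move: E; rewrite E2 E1 => E.
        by move: (cycle_edge_nonbridge e_sym gc E); rewrite (negPf br).
      rewrite cycle_edges_sym // in E.
      by move: (cycle_edge_nonbridge e_sym gc E); rewrite (negPf br).
    exists c; split=> //; apply/allP => u uC; apply: (connect_trans zw).
    case/and3P: gc' => _ _ cc.
    exact: connect_cycle cc _ _ wc uC.
  move=> rR sR xr; apply/negP => ys; apply: (core x y) => //.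
  by split; [apply: side xr rR | apply: side ys sR].
- move=> x y exy xR; rewrite in_bridge_arcs exy; apply: contra xR => cxy.
  have [c gc /mem_cycle_edges/andP[xc _]] := nonbridge_cycle e_sym e_irr exy cxy.
  by apply/mem_cycle_verticesP; exists c.
Qed.

Let deg x := #|arcs_from (arcs e) x|.

Lemma core_bicactus_bounds : 2 * #|T| < #|arcs e| -> (forall x, 0 < deg x) ->
  #|[set x | odd (deg x) && (1 < deg x)]| <= #|[set x | deg x == 1]| /\
  3 * #|arcs e| + 2 * #|[set x | deg x == 1]| + 8 <= 8 * #|T|.
Proof.
move=> big pos.
have [r _] : exists r : T, true.
  have : 0 < #|arcs e| by apply: leq_ltn_trans big.
  by case/card_gt0P=> -[r _] _; exists r.
have Kbig := card_cycle_sets e_sym e_irr r; rewrite -/K in Kbig.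
have K0 : 0 < #|K| by lia.
have B := card_bridge_arcs_core K0.
have S := card_arcs_split e_sym e_irr; rewrite -/K in S.
have C := card_cover_cycle_sets.
have RC := cardsC R.
have even x := even_cycle_degree x trivIset_cycle_sets; rewrite -/K in even.
pose b x := #|arcs_from (bridge_arcs e) x|.
have dE x : deg x = b x + #|arcs_from (cover K) x| by exact: card_arcs_from_split.
have inR x : (x \in R) = (0 < #|arcs_from (cover K) x|) by rewrite inE.
split.
  (* On [R] the cycle degree is even and positive, so an odd degree forces a bridge. Off [R] every
     incident edge is a bridge, and degree 1 is the only value below 2, compensated by the last
     term. Summing, the terms in the complement of [R] cancel. *)
  have: \sum_x (odd (deg x) && (1 < deg x) + 2 * (x \notin R)) <=
        \sum_x (b x + (deg x == 1)).
    apply: leq_sum => x _; rewrite inR; move: (even x) (pos x); rewrite dE.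
    by case: (#|arcs_from (cover K) x|) => [|[|m]]; lia.
  rewrite !big_split /= -card_arcs B big1_eq addn0.
  rewrite -!card_set_sum (_ : [set x | x \notin R] = ~: R); first by lia.
  by apply/setP => x; rewrite !inE.
(* A vertex on a cycle has degree at least 2. *)
have: #|[set x | deg x == 1]| <= #|~: R|.
  apply: subset_leq_card; apply/subsetP => x; rewrite in_setC inE inR dE.
  by move: (even x); case: (#|arcs_from (cover K) x|) => [|[|m]]; lia.
lia.
Qed.

End Necessity.

(** * Growing a core bi-cactus by leaves and squares *)

Section AddEdge.
Variable T : finType.
Implicit Types (e f : rel T) (c : seq T) (x y u v : T) (S R : {set T}).

Definition degree e x := #|[set y | e x y]|.

Definition add_edge e u v : rel T := fun x y =>
  e x y || ((x == u) && (y == v) || (x == v) && (y == u)).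

Lemma add_edge_sub e u v : subrel e (add_edge e u v).
Proof. by move=> x y; rewrite /add_edge => ->. Qed.

Lemma add_edge_sym e u v : symmetric e -> symmetric (add_edge e u v).
Proof.
move=> es x y; rewrite /add_edge es; congr (_ || _).
by rewrite orbC [(y == u) && _]andbC [(y == v) && _]andbC.
Qed.

Lemma add_edge_irr e u v : u != v -> irreflexive e -> irreflexive (add_edge e u v).
Proof.
move=> uv ei x; rewrite /add_edge ei /= orbC andbC orbb.
by apply/andP => -[/eqP-> /eqP E]; rewrite E eqxx in uv.
Qed.

Lemma degree_add_edge e u v x : u != v -> ~~ e u v -> ~~ e v u ->
  degree (add_edge e u v) x = degree e x + (x == u) + (x == v).
Proof.
move=> uv euv evu; rewrite /degree.
have [->|xu] := eqVneq x u.
  rewrite (negPf uv) (_ : [set y | _] = v |: [set y | e u y]).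
    by rewrite cardsU1 inE euv; lia.
  by apply/setP => y; rewrite !inE /add_edge eqxx (negPf uv) /= orbF orbC.
have [->|xv] := eqVneq x v.
  rewrite (_ : [set y | _] = u |: [set y | e v y]).
    by rewrite cardsU1 inE evu; lia.
  by apply/setP => y; rewrite !inE /add_edge eqxx eq_sym (negPf uv) /= orbC.
rewrite !addn0; apply: eq_card => y.
by rewrite !inE /add_edge (negPf xu) (negPf xv) orbF.
Qed.

Definition restrict S e : rel T := fun x y => [&& x \in S, y \in S & e x y].

(* The graph e lives on the vertex set S and its cycles on R: these two sets
   grow while the realization is assembled. *)
Record good S R e : Prop := Good {
  good_sym : symmetric e;
  good_irr : irreflexive e;
  good_supp : forall x y, e x y -> x \in S;
  good_sub : R \subset S;
  good_conn : {in S &, forall x y, connect e x y};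
  good_core_conn : {in R &, forall x y, connect (restrict R e) x y};
  good_core_edge : {in R &, forall x y, e x y -> connect (remove_edge e x y) x y};
  good_core_cycle : forall c, graph_cycle e c -> {subset c <= R};
  good_cactus : forall c1 c2 a, graph_cycle e c1 -> graph_cycle e c2 ->
    a \in cycle_edges c1 -> a \in cycle_edges c2 -> cycle_edges c1 = cycle_edges c2;
  good_bip : bipartite e }.

(** If both sides of a bridge contained cycles, both would meet [R]. An edge inside [R] is not a
    bridge by [good_core_edge]; any other edge is avoided by the paths inside [R] that join the two
    sides. *)
Lemma good_core_bicactus R e : good [set: T] R e -> core_bicactus e.
Proof.
case=> es ei _ _ conn cconn cedge ccyc cact bip; split=> //; split; first split.
- by move=> x y; apply: conn.
- by move=> u v c1 c2 _ g1 g2; apply: cact.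
move=> u v [euv /negP br] [[c1 [g1 a1]] [c2 [g2 a2]]]; apply: br.
have key w c : graph_cycle (remove_edge e u v) c -> all (connect (remove_edge e u v) w) c ->
    exists2 z, z \in R & connect (remove_edge e u v) w z.
  case/and3P=> uc sc cc /allP ac.
  have gc : graph_cycle e c.
    by apply/and3P; split=> //; apply: sub_cycle cc; apply: remove_edge_sub.
  have [z zc] : exists z, z \in c by case: (c) sc => // z s _; exists z; rewrite mem_head.
  by exists z; [apply: ccyc gc _ zc | apply: ac].
have [z1 z1R uz] := key _ _ g1 a1; have [z2 z2R vz] := key _ _ g2 a2.
have [/andP[uR vR]|nR] := boolP ((u \in R) && (v \in R)); first exact: cedge.
apply: (connect_trans uz); apply: (@connect_trans _ _ z2); last first.
  by rewrite sym_connect_sym //; apply: remove_edge_sym.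
apply: connect_mono (cconn _ _ z1R z2R) => x y /and3P[xR yR exy].
rewrite /remove_edge exy; apply: contra nR.
by case/orP=> /andP[/eqP <- /eqP <-]; rewrite xR yR.
Qed.

Lemma good_point (r : T) : good [set r] [set r] (fun _ _ => false).
Proof.
have nocyc c : ~ graph_cycle (fun _ _ : T => false) c.
  by case: c => [|x [|y c]] /and3P[].
split=> //.
- by move=> x y /set1P-> /set1P->.
- by move=> x y /set1P-> /set1P->.
- by move=> c /nocyc.
- by move=> c1 c2 a /nocyc.
by exists (fun _ => true).
Qed.

Lemma good_notin S R e x y : good S R e -> x \notin S -> e x y = false.
Proof. by move=> g; apply: contraNF => /(good_supp g). Qed.

Lemma graph_cycle_sub e f c (P : pred T) : {in P &, subrel f e} -> all P c ->
  graph_cycle f c -> graph_cycle e c.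
Proof.
move=> sub aP /and3P[uc sc cc]; apply/and3P; split=> //.
by apply: (@sub_in_cycle _ P f e) cc.
Qed.

(** The new vertex has a single neighbour, whereas on a cycle [next] and [prev] differ; so no new
    cycle arises and [R] stays unchanged. The leaf gets the colour opposite to that of [v]. *)
Lemma good_add_leaf S R e v x : good S R e -> v \in S -> x \notin S ->
  good (x |: S) R (add_edge e v x).
Proof.
move=> g vS xS; have vx : v != x by apply: contraNneq xS => <-.
set e' := add_edge e v x.
have es' : symmetric e' by apply: add_edge_sym; apply: good_sym g.
have sub : subrel e e' := @add_edge_sub e v x.
have ex y : e x y = false by apply: good_notin g xS.
have old c : graph_cycle e' c -> graph_cycle e c.
  move=> gc; have xc : x \notin c.
    apply/negP => xc; have /and3P[uc sc cc] := gc.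
    have nb y : e' x y -> y = v.
      by rewrite /e' /add_edge ex eqxx eq_sym (negPf vx) /= => /eqP.
    have /eqP := next_neq_prev uc sc xc; apply.
    rewrite (nb _ (next_cycle cc xc)); symmetry; apply: nb.
    by rewrite es'; apply: prev_cycle cc xc.
  apply: (graph_cycle_sub (P := predC1 x)) gc => [y z /= yx zx|].
    by rewrite /e' /add_edge (negPf yx) (negPf zx) !andbF !orbF.
  by apply/allP => z zc /=; apply: contraNneq xc => <-.
split=> //.
- exact: add_edge_irr vx (good_irr g).
- move=> y z /orP[/(good_supp g) yS|]; first by rewrite in_setU1 yS orbT.
  by rewrite in_setU1 => /orP[] /andP[/eqP-> _]; rewrite ?vS ?eqxx ?orbT.
- by apply: subset_trans (good_sub g) (subsetUr _ _).
- suff H y : y \in x |: S -> connect e' v y.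
    move=> y z /H vy /H vz; apply: connect_trans vz.
    by rewrite sym_connect_sym.
  rewrite in_setU1 => /orP[/eqP->|yS].
    by apply: connect1; rewrite /e' /add_edge !eqxx orbT.
  by apply: connect_mono sub _ _ _; apply: (good_conn g).
- move=> y z yR zR; apply: connect_mono (good_core_conn g yR zR).
  by move=> a b /and3P[aR bR /sub eab]; apply/and3P.
- move=> y z yR zR; rewrite {1}/e' /add_edge.
  have nx w : w \in R -> w == x = false.
    by move=> wR; apply: contraNF xS => /eqP <-; apply: (subsetP (good_sub g)).
  rewrite !nx // !andbF /= !orbF => /(good_core_edge g yR zR).
  by apply: connect_mono; apply: remove_edge_mono.
- by move=> c /old; apply: (good_core_cycle g).
- by move=> c1 c2 a /old g1 /old g2; apply: (good_cactus g g1 g2).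
have [f fP] := good_bip g; exists (fun y => if y == x then ~~ f v else f y) => y z.
rewrite /e' /add_edge => /orP[eyz|].
  have nx w w' : e w w' -> w == x = false.
    by move=> /(good_supp g) wS; apply: contraNF xS => /eqP <-.
  by rewrite (nx _ _ eyz) (nx z y) ?fP // (good_sym g).
by case/orP=> /andP[/eqP-> /eqP->]; rewrite eqxx (negPf vx); case: (f v).
Qed.

(** The disjuncts follow the order in which [add_square] adds its edges, so that the two match
    syntactically. *)
Lemma cycle_edges4 (v a b c x y : T) : uniq [:: v; a; b; c] ->
  ((x, y) \in cycle_edges [:: v; a; b; c]) =
  [|| (x == v) && (y == a) || (x == a) && (y == v),
      (x == a) && (y == b) || (x == b) && (y == a),
      (x == b) && (y == c) || (x == c) && (y == b) |
      (x == c) && (y == v) || (x == v) && (y == c)].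
Proof.
rewrite /= !inE !negb_or => /and4P[/and3P[va vb vc] /andP[ab ac] bc _] /=.
have [->|xv] := eqVneq x v.
  rewrite (negPf va) (negPf vb) (negPf vc) /= ![_ == y]eq_sym.
  by case: (y == a); case: (y == c).
have [->|xa] := eqVneq x a.
  rewrite (negPf ab) (negPf ac) /= ![_ == y]eq_sym.
  by case: (y == v); case: (y == b).
have [->|xb] := eqVneq x b.
  rewrite (negPf bc) /= ![_ == y]eq_sym.
  by case: (y == a); case: (y == c).
have [_|_] //= := eqVneq x c.
by rewrite ![_ == y]eq_sym; case: (y == b); case: (y == v).
Qed.

Definition add_square e (v a b c : T) :=
  add_edge (add_edge (add_edge (add_edge e v a) a b) b c) c v.

(** The square arises from three successive leaves and a closing edge. Since [a], [b], [c] have only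
    neighbours on the square, a cycle through one of them contains all edges of the square and
    therefore equals it; all other cycles are old. *)
Lemma good_add_square S R e (v a b c : T) : good S R e -> v \in R ->
  uniq [:: a; b; c] -> a \notin S -> b \notin S -> c \notin S ->
  good (c |: (b |: (a |: S))) (c |: (b |: (a |: R))) (add_square e v a b c).
Proof.
move=> g vR uabc aS bS cS.
have vS : v \in S by apply: (subsetP (good_sub g)).
have usq : uniq [:: v; a; b; c].
  rewrite [uniq _]/= -/(uniq [:: a; b; c]) uabc andbT !inE !negb_or.
  by apply/and3P; split; apply: contraTneq vS => ->.
have [nab nac nbc] : [/\ a != b, a != c & b != c].
  by move: uabc; rewrite /= !inE negb_or => /and3P[/andP[]].
have g1 := good_add_leaf g vS aS.
have g2 : good (b |: (a |: S)) R (add_edge (add_edge e v a) a b).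
  apply: (good_add_leaf g1); rewrite !inE ?eqxx //.
  by rewrite negb_or eq_sym nab.
have g3 : good (c |: (b |: (a |: S))) R (add_edge (add_edge (add_edge e v a) a b) b c).
  apply: (good_add_leaf g2); rewrite !inE ?eqxx //.
  by rewrite !negb_or ![c == _]eq_sym nac nbc.
set e' := add_square e v a b c.
have eE x y : e' x y = e x y || ((x, y) \in cycle_edges [:: v; a; b; c]).
  by rewrite cycle_edges4 // /e' /add_square /add_edge -!orbA.
have es' : symmetric e' by apply: add_edge_sym; apply: good_sym g3.
have sub3 := @add_edge_sub (add_edge (add_edge (add_edge e v a) a b) b c) c v.
have sub : subrel e e' by move=> x y; rewrite eE => ->.
have subR : R \subset c |: (b |: (a |: R)).
  by apply/subsetP => x; rewrite !inE => ->; rewrite !orbT.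
have gsq : graph_cycle e' [:: v; a; b; c].
  rewrite /graph_cycle usq /= !eE !cycle_edges4 // !eqxx /=.
  by rewrite !orbT.
have new x y : e x y -> [&& x != a, x != b & x != c].
  move/(good_supp g) => xS.
  by apply/and3P; split; apply: contraTneq xS => ->.
have nbr z y : z \in [:: a; b; c] -> e' z y -> (z, y) \in cycle_edges [:: v; a; b; c].
  move=> zin; rewrite eE => /orP[/new|//].
  by move: zin; rewrite !inE => /or3P[] /eqP->; rewrite eqxx ?andbF.
have cyc C : graph_cycle e' C ->
    graph_cycle e C \/ cycle_edges C = cycle_edges [:: v; a; b; c].
  move=> gC; have [hC|nC] := boolP (has (mem [:: a; b; c]) C).
    right; symmetry; apply: (cycle_edges_subset_eq gsq gC).
    have /and3P[uC sC _] := gC.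
    have row z : z \in [:: a; b; c] -> z \in C -> forall y,
        ((z, y) \in cycle_edges C) = ((z, y) \in cycle_edges [:: v; a; b; c]).
      move=> zin zC y; rewrite -!in_arcs_from.
      suff -> : arcs_from (cycle_edges C) z = arcs_from (cycle_edges [:: v; a; b; c]) z by [].
      apply/eqP.
      rewrite eqEcard !card_cycle_row // zC; apply/andP; split; last by case: ifP.
      apply/subsetP => w; rewrite !in_arcs_from => /(cycle_edges_rel es' gC).
      exact: nbr.
    have [ina inb inc] : [/\ a \in [:: a; b; c], b \in [:: a; b; c] & c \in [:: a; b; c]].
      by rewrite !inE !eqxx !orbT.
    have aC_bC : a \in C -> b \in C.
      move=> aC; have : (a, b) \in cycle_edges C.
        by rewrite row // cycle_edges4 // !eqxx !orbT.
      by case/mem_cycle_edges/andP.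
    have bC_all : b \in C -> (a \in C) && (c \in C).
      move=> bC; have [ba bc] : (b, a) \in cycle_edges C /\ (b, c) \in cycle_edges C.
        by rewrite !row // !cycle_edges4 // !eqxx !orbT.
      by case/mem_cycle_edges/andP: ba => _ ->; case/mem_cycle_edges/andP: bc.
    have cC_bC : c \in C -> b \in C.
      move=> cC; have : (c, b) \in cycle_edges C.
        by rewrite row // cycle_edges4 // !eqxx !orbT.
      by case/mem_cycle_edges/andP.
    have bC : b \in C.
      case/hasP: hC => z zC; rewrite -[mem _ z]/(z \in [:: a; b; c]) !inE.
      by case/or3P=> /eqP E; move: zC; rewrite E.
    have /andP[aC cC] := bC_all bC.
    have inC z : z \in [:: a; b; c] -> z \in C.
      by rewrite !inE => /or3P[] /eqP->.
    apply/subsetP => -[x y] xy; have [xin|xn] := boolP (x \in [:: a; b; c]).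
      by rewrite row // inC.
    have yin : y \in [:: a; b; c].
      move: xy xn; rewrite cycle_edges4 // !inE !negb_or.
      move=> H /and3P[/negPf E1 /negPf E2 /negPf E3]; move: H.
      rewrite E1 E2 E3 /= !orbF; case/orP=> /andP[_ ->]; by rewrite ?orbT.
    by rewrite cycle_edges_sym // row ?inC // -cycle_edges_sym.
  left; apply: (graph_cycle_sub (P := predC (mem [:: a; b; c]))) gC; last first.
    by rewrite all_predC.
  move=> x y /= xn yn; rewrite eE => /orP[//|]; rewrite cycle_edges4 //.
  move: xn yn; rewrite !inE !negb_or => /and3P[/negPf-> /negPf-> /negPf->].
  by case/and3P=> /negPf-> /negPf-> /negPf->; rewrite !andbF.
have nR z : z \in [:: a; b; c] -> z \notin R.
  move=> zin; apply/negP => /(subsetP (good_sub g)); apply/negP.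
  by move: zin; rewrite !inE => /or3P[] /eqP->.
split=> //.
- apply: add_edge_irr (good_irr g3); apply: contraNneq cS => ->; exact: vS.
- move=> x y /orP[/(good_supp g3)//|].
  by rewrite !inE => /orP[] /andP[/eqP-> _]; rewrite ?eqxx ?vS ?orbT.
- by do 3!apply: setUS; apply: good_sub g.
- move=> x y xS yS; apply: (connect_mono sub3).
  exact: good_conn g3 _ _ xS yS.
- set R' := c |: _.
  have rs : symmetric (restrict R' e').
    by move=> x y; rewrite /restrict es' andbCA.
  suff H y : y \in R' -> connect (restrict R' e') v y.
    move=> y z /H vy /H vz; apply: connect_trans vz.
    by rewrite sym_connect_sym.
  have inR z : z \in [:: v; a; b; c] -> z \in R'.
    by rewrite !inE => /or4P[] /eqP->; rewrite ?eqxx ?vR ?orbT.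
  have [yR _|yR] := boolP (y \in R).
    apply: connect_mono (good_core_conn g vR yR) => x z /and3P[xR zR exz].
    by rewrite /restrict !(subsetP subR) //=; apply: sub.
  move=> yR'; have yin : y \in [:: v; a; b; c].
    by move: yR'; rewrite !inE (negPf yR) orbF => /or3P[] ->; rewrite ?orbT.
  have gr : cycle (restrict R' e') [:: v; a; b; c].
    apply: (cycle_from_next usq) => x xin; rewrite /restrict eE next_cycle_edges // orbT.
    by rewrite !inR ?mem_next.
  by apply: connect_cycle gr _ _ _ yin; rewrite mem_head.
- move=> x y xR yR; rewrite {1}eE => /orP[exy|xy].
    have old z w : e z w -> z \in c |: (b |: (a |: R)) -> z \in R.
      by move/new => /and3P[/negPf za /negPf zb /negPf zc]; rewrite !inE za zb zc.
    apply: connect_mono (good_core_edge g (old _ _ exy xR) _ exy).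
      exact: remove_edge_mono.
    by apply: old yR; rewrite (good_sym g); apply: exy.
  exact: cycle_edge_nonbridge gsq xy.
- move=> C gC x xC; case: (cyc _ gC) => [gC'|E].
    by apply: (subsetP subR); apply: (good_core_cycle g gC').
  have := next_cycle_edges xC; rewrite E => /mem_cycle_edges/andP[+ _]; rewrite !inE.
  by case/or4P => /eqP->; rewrite ?eqxx ?vR ?orbT.
- have mixed C x y : graph_cycle e C -> (x, y) \in cycle_edges C ->
      (x, y) \in cycle_edges [:: v; a; b; c] -> False.
    move=> gC xyC; have exy := cycle_edges_rel (good_sym g) gC xyC.
    have eyx : e y x by rewrite (good_sym g).
    have /and3P[/negPf x1 /negPf x2 /negPf x3] := new _ _ exy.
    have /and3P[/negPf y1 /negPf y2 /negPf y3] := new _ _ eyx.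
    by rewrite cycle_edges4 // x1 x2 x3 y1 y2 y3 !andbF.
  move=> c1 c2 [x y] /cyc[] H1 /cyc[] H2; last by rewrite H1 H2.
  + exact: (good_cactus g H1 H2).
  + by rewrite H2 => xy1 /(mixed _ _ _ H1 xy1).
  + by rewrite H1 => xy1 xy2; case: (mixed _ _ _ H2 xy2 xy1).
have [f fP] := good_bip g3; exists f => x y /orP[/fP//|].
have va : f v != f a by apply: fP; rewrite /add_edge !eqxx !orbT.
have ab : f a != f b by apply: fP; rewrite /add_edge !eqxx !orbT.
have bc : f b != f c by apply: fP; rewrite /add_edge !eqxx !orbT.
(* The colour flips three times from [v] to [c], so the closing edge respects the colouring. *)
have cv : f c != f v by move: va ab bc; case: (f v); case: (f a); case: (f b); case: (f c).
by case/orP=> /andP[/eqP-> /eqP->]; rewrite // eq_sym.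
Qed.

End AddEdge.

(** * Sufficiency: constructing the realization *)

Section Sufficiency.
Variable T : finType.
Implicit Types (e : rel T) (x y u v : T) (S R : {set T}) (d g h w : T -> nat).

Lemma degree_notin S R e x : good S R e -> x \notin S -> degree e x = 0.
Proof.
by move=> gd xS; apply: eq_card0 => y; rewrite inE (good_notin _ gd xS).
Qed.

Lemma degree_add_leaf S R e v x y : good S R e -> v \in S -> x \notin S ->
  degree (add_edge e v x) y = degree e y + (y == v) + (y == x).
Proof.
move=> gd vS xS; apply: degree_add_edge.
- by apply: contraNneq xS => <-.
- by rewrite (good_sym gd) (good_notin _ gd xS).
- by rewrite (good_notin _ gd xS).
Qed.

Lemma degree_add_square S R e (v a b c x : T) : good S R e -> v \in S ->
  uniq [:: a; b; c] -> a \notin S -> b \notin S -> c \notin S ->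
  degree (add_square e v a b c) x =
  degree e x + 2 * ((x == v) + (x == a) + (x == b) + (x == c)).
Proof.
move=> gd vS uabc aS bS cS.
have [nab nac nbc] : [/\ a != b, a != c & b != c].
  by move: uabc; rewrite /= !inE negb_or => /and3P[/andP[]].
have nS z : z \notin S -> v == z = false by move=> zS; apply: contraNF zS => /eqP <-.
have ez z y : z \notin S -> e z y = false by apply: good_notin gd.
have ze z y : z \notin S -> e y z = false by rewrite (good_sym gd); apply: ez.
rewrite !degree_add_edge ?(eq_sym c v) ?nS //.
  by clear; move: (x == v) (x == a) (x == b) (x == c) (degree e x) => [] [] [] []; lia.
all: rewrite /add_edge ?(ez a _ aS) ?(ez b _ bS) ?(ez c _ cS) ?(ze a _ aS) ?(ze c _ cS) //.
all: rewrite ?(eq_sym b a) ?(eq_sym c a) ?(eq_sym c b).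
all: rewrite ?(eq_sym a v) ?(eq_sym b v) ?(eq_sym c v).
all: by rewrite ?(nS a aS) ?(nS b bS) ?(nS c cS) ?(negPf nab) ?(negPf nac) ?(negPf nbc) ?andbF.
Qed.

(** [w x] prescribes the number of squares through [x]. The induction strips off an outermost
    square, hanging at [v], whose other three vertices have weight 1. For [k = 0] the single vertex
    has weight 0, whence the guard on positivity. *)
Lemma core_realization k S w : #|S| = 3 * k + 1 -> \sum_(x in S) w x = 4 * k ->
  (0 < k -> {in S, forall x, 0 < w x}) ->
  exists2 e, good S S e & {in S, forall x, degree e x = 2 * w x}.
Proof.
elim: k S w => [|k IHk] S w cS sw wpos.
  have /cards1P[r Sr] : #|S| == 1 by rewrite cS.
  exists (fun _ _ => false); first by rewrite Sr; apply: good_point.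
  move=> x; rewrite Sr => /set1P ->; move: sw; rewrite Sr big_set1 => ->.
  by apply: eq_card0 => y; rewrite inE.
(* If further squares remain, [v] must keep a positive weight after losing one. Such a [v] exists
   because 4(k+1) exceeds the number 3(k+1) + 1 of vertices when [k] is positive. *)
have [v vS vk] : exists2 v, v \in S & (0 < k -> 1 < w v).
  have [k0|kpos] := posnP k.
    have /card_gt0P[v vS] : 0 < #|S| by rewrite cS addn1.
    by exists v; rewrite ?k0.
  have [/existsP[v /andP[vS wv]]|/existsPn none] := boolP [exists v in S, 1 < w v].
    by exists v.
  have: \sum_(x in S) w x <= \sum_(x in S) 1.
    apply: leq_sum => x xS; move: (none x); rewrite xS /=; lia.
  by rewrite sum1_card cS sw; lia.
(* [U] holds the candidates for the other three corners. The weights total only 4(k+1) over 3k + 4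
   vertices, which leaves at least 2k + 3 candidates. *)
pose U := [set x in S | (x != v) && (w x == 1)].
have cU : 2 < #|U|.
  have: \sum_(x in S) 2 <= \sum_(x in S) (w x + (x \in U) + (x == v)).
    apply: leq_sum => x xS; rewrite inE xS /=; have := wpos isT x xS.
    by case: eqVneq => _ /=; lia.
  rewrite !big_split /= sum_nat_const cS sw.
  have -> : \sum_(x in S) (x \in U : nat) = #|U|.
    rewrite -[RHS]sum1_card [LHS]big_mkcond [RHS]big_mkcond /=; apply: eq_bigr => x _.
    by rewrite [in RHS]inE inE; case: (x \in S) => //=; case: ifP.
  have -> : \sum_(x in S) (x == v : nat) = 1.
    by rewrite (bigD1 v) //= eqxx big1 // => x /andP[_ /negPf->].
  by lia.
have [a [b [c [uabc aU bU cU']]]] : exists a b c,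
    [/\ uniq [:: a; b; c], a \in U, b \in U & c \in U].
  move: cU; rewrite cardE; have := enum_uniq U; have := mem_enum U.
  case: (enum U) => [|a [|b [|c s]]] // mE uE _; exists a, b, c.
  rewrite -!mE !inE !eqxx !orbT; split=> //.
  by move: uE; rewrite -[_ :: _]/([:: a; b; c] ++ s) cat_uniq => /andP[].
have [nab nac nbc] : [/\ a != b, a != c & b != c].
  by move: uabc; rewrite /= !inE negb_or => /and3P[/andP[]].
move: aU bU cU'; rewrite !inE.
move=> /and3P[aS av /eqP wa] /and3P[bS bv /eqP wb] /and3P[cS' cv /eqP wc].
have [S' [ES vS' aS0 bS0 cS0]] : exists S',
    [/\ S = c |: (b |: (a |: S')), v \in S', a \notin S', b \notin S' & c \notin S'].
  exists (S :\ c :\ b :\ a); rewrite !setD1K //.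
  - by rewrite !inE !eqxx vS !(eq_sym v) av bv cv !andbF.
  - by rewrite !inE bS nbc.
  - by rewrite !inE aS nab nac.
have bS1 : b \notin a |: S' by rewrite in_setU1 negb_or eq_sym nab.
have cS1 : c \notin b |: (a |: S') by rewrite !in_setU1 !negb_or !(eq_sym c) nac nbc.
pose w' x := w x - (x == v).
have sw' : \sum_(x in S') w' x = 4 * k.
  have sv : \sum_(x in S') w x = \sum_(x in S') w' x + 1.
    have wv : w v = w' v + 1 by rewrite /w' eqxx subnK // wpos.
    rewrite (bigD1 v) //= [in RHS](bigD1 v) //= wv (eq_bigr w') => [|x /andP[_ /negPf xv]].
      by rewrite addnAC.
    by rewrite /w' xv subn0.
  by move: sw; rewrite ES !big_setU1 //= wa wb wc sv; clear; lia.
have cS'' : #|S'| = 3 * k + 1.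
  by move: cS; rewrite ES !cardsU1 aS0 bS1 cS1; clear; lia.
have wpos' : 0 < k -> {in S', forall x, 0 < w' x}.
  move=> kpos x xS'; have xS : x \in S by rewrite ES !in_setU1 xS' !orbT.
  have := vk kpos; have := wpos isT x xS; rewrite /w'.
  by case: eqVneq => [->|_]; clear; lia.
have [e ge de] := IHk S' w' cS'' sw' wpos'.
exists (add_square e v a b c).
  by rewrite ES; apply: good_add_square.
move=> x xS; rewrite (degree_add_square _ ge) //.
have [xS'|xn] := boolP (x \in S').
  have nx z : z \notin S' -> x == z = false by apply: contraNF => /eqP <-.
  rewrite de // (nx a) // (nx b) // (nx c) // /w'; have := wpos isT x xS; clear.
  by case: (x == v); lia.
rewrite (degree_notin ge xn) (_ : x == v = false); last by apply: contraNF xn => /eqP ->.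
move: xS; rewrite ES !in_setU1 (negPf xn) orbF => /or3P[] /eqP->.
- by rewrite eqxx wc !(eq_sym c) (negPf nac) (negPf nbc).
- by rewrite eqxx wb (negPf nbc) (eq_sym b) (negPf nab).
- by rewrite eqxx wa (negPf nab) (negPf nac).
Qed.

(* Vertices of degree at least 2 are attached first: each of them leaves a free
   slot for the next vertex. *)
Lemma attach_remaining S R e d : good S R e -> (forall x, 0 < d x) ->
  {in S, forall x, degree e x <= d x} ->
  \sum_x d x + 2 * #|S| = \sum_x degree e x + 2 * #|T| ->
  (S != setT -> exists2 v, v \in S & degree e v < d v) ->
  exists2 e', good setT R e' & forall x, degree e' x = d x.
Proof.
(* The sum hypothesis is an invariant: the missing degree is twice the number of vertices outside
   [S], and each leaf edge uses up two units. *)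
move=> + dpos; have [n] := ubnP #|~: S|.
elim: n S e => // n IHn S e; rewrite ltnS => cn ge led sd free.
have [ST|SnT] := eqVneq S setT.
  exists e; first by rewrite -ST.
  move: sd; rewrite ST cardsT => /addIn sd x.
  have le y : true -> degree e y <= d y ?= iff (degree e y == d y).
    by move=> _; apply/leqif_eq/led; rewrite ST.
  have [_] := leqif_sum le; rewrite sd eqxx => /esym/forallP/(_ x).
  by move/eqP.
have [v vS vfree] := free SnT.
have cST := cardsC S.
have step x : x \notin S -> (x |: S != setT ->
      exists2 u, u \in x |: S & degree (add_edge e v x) u < d u) ->
    exists2 e', good setT R e' & forall x, degree e' x = d x.
  move=> xS; have dE y := degree_add_leaf y ge vS xS.
  have vx : v == x = false by apply: contraNF xS => /eqP <-.
  have cx : #|~: (x |: S)| < #|~: S|.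
    by have := cardsC (x |: S); rewrite cardsU1 xS; lia.
  apply: (IHn _ _ (leq_trans cx cn)) (good_add_leaf ge vS xS) _ _.
    move=> y; rewrite in_setU1 dE => /orP[/eqP->|yS].
      by rewrite (degree_notin ge xS) eq_sym vx eqxx; apply: dpos.
    have -> : y == x = false by apply: contraNF xS => /eqP <-.
    by have := led _ yS; case: eqVneq => [->|_]; lia.
  rewrite (eq_bigr _ (fun y _ => dE y)) !big_split /= cardsU1 xS.
  by rewrite !sum_eq1; move: sd; move: #|T| => N; lia.
have [/existsP[x /andP[xS dx]]|/existsPn none] := boolP [exists x in ~: S, 1 < d x].
  rewrite in_setC in xS; apply: (step x xS) => _; exists x; first by rewrite setU11.
  rewrite (degree_add_leaf _ ge) // (degree_notin ge) // eqxx.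
  by rewrite (_ : x == v = false) //; apply: contraNF xS => /eqP ->.
have [x xS] : exists x, x \notin S.
  apply/existsP; apply: contraNT SnT => /existsPn H.
  by apply/eqP/setP => y; rewrite inE; apply: negbNE.
apply: (step x xS) => xST; set S' := x |: S; set e' := add_edge e v x.
have ge' : good S' R e' := good_add_leaf ge vS xS.
have [/existsP[u /andP[uS du]]|/existsPn full] :=
    boolP [exists u in S', degree e' u < d u]; first by exists u.
(* Only vertices of degree 1 are left outside. Without a free slot in [S'] the missing degree would
   be at most their number, while the invariant makes it twice that positive number. *)
exfalso.
have: \sum_y d y <= \sum_y (degree e' y + (y \in ~: S')).
  apply: leq_sum => y _; move: (full y) (none y); rewrite !inE.
  by case: (y == x); case: (y \in S) => /=; lia.
rewrite big_split /= (eq_bigr _ (fun y _ => degree_add_leaf y ge vS xS)) !big_split /=.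
have -> : \sum_y (y \in ~: S' : nat) = #|~: S'|.
  by rewrite -[RHS]sum1_card [RHS]big_mkcond; apply: eq_bigr => y _; case: ifP.
rewrite !sum_eq1; have := cardsC S'; rewrite cardsU1 xS.
have : 0 < #|~: S'|.
  rewrite lt0n cards_eq0; apply: contraNneq xST => E.
  by apply/eqP; rewrite -[LHS]setCK E setC0.
by move: sd; move: #|T| => N; lia.
Qed.

Lemma sub_sum h k : k <= \sum_x h x ->
  exists2 g, forall x, g x <= h x & \sum_x g x = k.
Proof.
elim: k => [|k IHk] lek; first by exists (fun _ => 0); rewrite ?big1_eq.
have [g gh sg] := IHk (ltnW lek).
have [/existsP[u gu]|/existsPn H] := boolP [exists u, g u < h u].
  exists (fun x => g x + (x == u)).
    by move=> x; have := gh x; case: eqVneq => [->|_]; lia.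
  rewrite big_split /= sg (bigD1 u) //= eqxx big1; first by lia.
  by move=> x /negPf->.
have: \sum_x h x <= \sum_x g x by apply: leq_sum => x _; move: (H x); lia.
by lia.
Qed.

Lemma set_between (Q P : {set T}) k : Q \subset P -> #|Q| <= k <= #|P| ->
  exists S, [/\ Q \subset S, S \subset P & #|S| = k].
Proof.
move=> QP /andP[]; elim: k => [|k IHk].
  by rewrite leqn0 => /eqP cQ _; exists Q.
rewrite leq_eqVlt => /orP[/eqP cQ _|cQ cP]; first by exists Q.
have [S [QS SP cS]] := IHk cQ (ltnW cP).
have /properP[_ [x xP xS]] : S \proper P by rewrite properEcard SP cS.
exists (x |: S); rewrite cardsU1 xS cS; split=> //.
  by apply: subset_trans QS (subsetUr _ _).
by rewrite subUset sub1set xP.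
Qed.

Lemma core_bicactus_exists d k : (forall x, 0 < d x) ->
  \sum_x d x + 2 = 2 * #|T| + 2 * k -> 0 < k ->
  0 < #|[set x | d x == 1]| ->
  #|[set x | odd (d x) && (1 < d x)]| <= #|[set x | d x == 1]| ->
  3 * k + 1 + #|[set x | d x == 1]| <= #|T| ->
  exists e, [/\ symmetric e, irreflexive e, forall x, degree e x = d x & core_bicactus e].
Proof.
move=> dpos sd kpos mu1_gt0 mu_le kT.
have two : \sum_(x : T) 2 = 2 * #|T| by rewrite sum_nat_const mulnC.
(* [g x] counts the squares through [x] beyond the first. The capacities suffice: twice their sum is
   2(k - 1) plus the excess of the number of degree-1 vertices over that of odd vertices of degree
   above 1. *)
have [g gh sg] : exists2 g, forall x, g x <= (d x)./2 - 1 & \sum_x g x = k - 1.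
  apply: sub_sum; move: mu_le; rewrite !card_set_sum => mu_le.
  have: \sum_x (d x + (d x == 1)) =
        \sum_x (((d x)./2 - 1) + ((d x)./2 - 1) + (odd (d x) && (1 < d x)) + 2).
    by apply: eq_bigr => x _; have := dpos x; lia.
  by rewrite !big_split /= two; lia.
(* [u] keeps a free slot for the first leaf. If all vertices of degree at least 2 were saturated,
   the degree sum would leave no room for a vertex of degree 1. *)
have [u [u2 du]] : exists u, 1 < d u /\ 2 * (g u).+1 < d u.
  have [/existsP[u /andP[u1 u2]]|/existsPn H] :=
      boolP [exists u, (1 < d u) && (2 * (g u).+1 < d u)]; first by exists u.
  have: \sum_x (d x + (d x == 1)) <= \sum_x (g x + g x + 2).
    by apply: leq_sum => x _; have := H x; have := dpos x; lia.
  by rewrite !big_split /= -card_set_sum two; lia.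
pose P := [set x | 1 < d x].
pose Q := u |: [set x | 0 < g x].
(* The core must contain [Q], of size at most k, and lie within [P], of size at least 3k + 1. *)
have [S [QS SP cS]] : exists S, [/\ Q \subset S, S \subset P & #|S| = 3 * k + 1].
  apply: set_between.
    apply/subsetP => x; rewrite !inE => /orP[/eqP->//|gx].
    by have := gh x; lia.
  apply/andP; split.
    rewrite cardsU1; have: #|[set x | 0 < g x]| <= \sum_x g x.
      by rewrite card_set_sum; apply: leq_sum => x _; lia.
    by case: (u \notin _); lia.
  have: #|P| + #|[set x | d x == 1]| = #|T|.
    rewrite !card_set_sum -big_split /= -[#|T|]sum1_card; apply: eq_bigr => x _.
    by have := dpos x; lia.
  lia.
have uS : u \in S by apply: (subsetP QS); rewrite setU11.
have sgS : \sum_(x in S) g x = k - 1.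
  rewrite -sg [RHS](bigID (mem S)) /= [X in _ = _ + X]big1 ?addn0 // => x.
  by apply: contraNeq => gx; apply: (subsetP QS); rewrite !inE lt0n gx orbT.
(* The total is (k - 1) + (3k + 1). *)
have sw : \sum_(x in S) (g x).+1 = 4 * k.
  rewrite (eq_bigr (fun x => g x + 1)) => [|x _]; last by rewrite addn1.
  by rewrite big_split /= sgS sum1_card cS; lia.
have [e ge de] := core_realization cS sw (fun _ _ _ => ltn0Sn _).
have [|||e' ge' de'] := attach_remaining ge dpos.
- move=> x xS; rewrite de //; have := subsetP SP x xS; rewrite inE.
  by have := gh x; lia.
- rewrite [X in _ = X + _](bigID (mem S)) /= [X in _ + X + _]big1; last first.
    by move=> x; apply: degree_notin ge.
  by rewrite (eq_bigr _ de) -big_distrr /= sw cS; move: sd; move: #|T| => N; lia.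
- by move=> _; exists u; rewrite // de.
exists e'; split=> //; [exact: good_sym ge' | exact: good_irr ge' |].
exact: good_core_bicactus ge'.
Qed.

End Sufficiency.

(** * From degree sequences to degree functions on vertices *)

Theorem theorem6p5 (n : nat) (d : seq nat) :
  degree_sequence n d ->
  2 <= nth 0 d 3 ->
  2 * n < sumn d ->
  0 < mu1 d ->
  (exists e : rel 'I_n, realizes d e /\ core_bicactus e) <->
  (mu_odd d <= mu1 d /\ sumn d %/ 2 <= (4 * (n - 1) - mu1 d) %/ 3).
Proof.
move=> [sz bnd ev _] _ big mu1_gt0.
pose D (i : 'I_n) := nth 0 d i.
have Dpos i : 0 < D i.
  have : D i \in d by apply: mem_nth; rewrite sz.
  by move/(allP bnd)/andP => [].
have sumE (F : nat -> nat) : \sum_(x <- d) F x = \sum_i F (D i).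
  by rewrite (big_nth 0) sz big_mkord.
have cntE (P : pred nat) : count P d = #|[set i | P (D i)]|.
  rewrite -sum1_count -sum1_card big_mkcond (sumE (fun x => if P x then 1 else 0)).
  by rewrite -big_mkcond; apply: eq_bigl => i; rewrite inE.
have sumD : sumn d = \sum_i D i by rewrite sumnE sumE.
have m1 : mu1 d = #|[set i | D i == 1]| by apply: cntE.
have mo : mu_odd d = #|[set i | odd (D i) && (1 < D i)]| by apply: cntE.
have mun : mu1 d <= n by rewrite m1 -[n in _ <= n]card_ord max_card.
split=> [[e [[[es ei] de] core]]|[le1 le2]].
  have degE i : #|arcs_from (arcs e) i| = D i.
    by rewrite -[D i]de; apply: eq_card => j; rewrite in_arcs_from !inE.
  have aE : #|arcs e| = sumn d by rewrite card_arcs sumD; apply: eq_bigr.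
  have [] := core_bicactus_bounds es ei core.
  - by rewrite card_ord aE.
  - by move=> i; rewrite degE.
  have setE (P : pred nat) : [set x | P #|arcs_from (arcs e) x|] = [set x | P (D x)].
    by apply/setP => i; rewrite !inE degE.
  rewrite (setE (fun m => m == 1)) (setE (fun m => odd m && (1 < m))) -m1 -mo aE card_ord.
  by move=> -> H; split=> //; lia.
(* Here k = m - n + 1, where the division is exact by parity and the subtraction by m > n; the bound
   on m becomes 3k + 1 + [mu1 d] <= n. *)
have [|||||e [es ei de core]] := @core_bicactus_exists _ D (sumn d %/ 2 - n + 1) Dpos.
- rewrite -sumD card_ord; lia.
- by lia.
- by rewrite -m1.
- by rewrite -m1 -mo.
- by rewrite -m1 card_ord; lia.
by exists e; split=> //; split.
Qed.
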